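(* Let $T$ be a unital ring, ${}_TP$ a left $T$-module, $S:=\mathrm{End}({}_TP)^{op}$, and let $\mathcal{M}=(T,S,P,Q,\langle,\rangle_T,\langle,\rangle_S)$ be a unital Morita context; put $J:=\mathrm{Im}(\langle,\rangle_S)$. (1) If $\mathbf{P}_r:=(Q,P_S)$ satisfies the right $\alpha$-condition over $S$, then: (a) $\mathrm{Gen}({}_TP)=\mathrm{Stat}^l({}_TP_S)$; (b) there is an equivalence of categories $\mathrm{Gen}({}_TP)\approx\mathrm{Copres}({}_S^{\#}P)$; (c) ${}_TP$ is $\sum$-self-static and $\mathrm{Stat}^l({}_TP_S)$ is closed under factor modules; (d) $\mathrm{Gen}({}_TP)=\mathrm{Pres}({}_TP)$. (2) If $\mathcal{M}$ satisfies the right $\alpha$-condition and $\mathrm{Cogen}({}_S^{\#}P)\subseteq{}_J\mathcal{L}$, then: (a) $\mathrm{Gen}({}_TP)=\mathrm{Stat}^l({}_TP_S)$ and $\mathrm{Cogen}({}_S^{\#}P)=\mathrm{Adstat}^l({}_TP_S)$; (b) there is an equivalence of categories $\mathrm{Cogen}({}_S^{\#}P)\approx\mathrm{Gen}({}_TP)$; (c) ${}_TP$ is a $\ast$-module; (d) ${}_TP$ is self-tilting and self-small.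
   Context: All rings are associative with unity and all modules unitary. $P$ is regarded as a $(T,S)$-bimodule with its canonical right action of $S=\mathrm{End}({}_TP)^{op}$. A unital Morita context $(T,S,P,Q,\langle,\rangle_T,\langle,\rangle_S)$ consists of rings $T,S$, a $(T,S)$-bimodule $P$, an $(S,T)$-bimodule $Q$, a $(T,T)$-bilinear map $\langle,\rangle_T:P\otimes_SQ\to T$ and an $(S,S)$-bilinear map $\langle,\rangle_S:Q\otimes_TP\to S$, such that $\langle q,p\rangle_Sq'=q\langle p,q'\rangle_T$ and $p\langle q,p'\rangle_S=\langle p,q\rangle_Tp'$ for all $p,p'\in P$, $q,q'\in Q$. $\mathbf{P}_r=(Q,P_S)$ satisfies the right $\alpha$-condition over $S$ if for every left $S$-module $U$ the map $P\otimes_SU\to\mathrm{Hom}_{S}(Q,U)$, $p\otimes u\mapsto[q\mapsto\langle q,p\rangle_Su]$, is injective. $\mathbf{Q}_r=(P,Q_T)$ satisfies the right $\alpha$-condition over $T$ if for every left $T$-module $U$ the map $Q\otimes_TU\to\mathrm{Hom}_{T}(P,U)$, $q\otimes u\mapsto[p\mapsto\langle p,q\rangle_Tu]$, is injective. $\mathcal{M}$ satisfies the right $\alpha$-condition if both hold. Fix an injective cogenerator ${}_T\mathbf{E}$ of the category of left $T$-modules; ${}_S^{\#}P:=\mathrm{Hom}_T(P,{}_T\mathbf{E})$ with left $S$-action $(sf)(p)=f(ps)$. For a module $U$: $\mathrm{Gen}(U)$ is the class of epimorphic images of direct sums $U^{(\Lambda)}$; $\mathrm{Pres}(U)$ is the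 class of $V$ with an exact sequence $U^{(\Lambda_2)}\to U^{(\Lambda_1)}\to V\to0$; $\mathrm{Cogen}(U)$ is the class of submodules (up to isomorphism) of products $U^{\Lambda}$; $\mathrm{Copres}(U)$ is the class of $W$ with an exact sequence $0\to W\to U^{\Lambda_1}\to U^{\Lambda_2}$. These are regarded as full subcategories. $\mathrm{Stat}^l({}_TP_S)$ = left $T$-modules $K$ for which evaluation $P\otimes_S\mathrm{Hom}_T(P,K)\to K$ is an isomorphism (the ''$P$-static'' modules); $\mathrm{Adstat}^l({}_TP_S)$ = left $S$-modules $L$ for which $L\to\mathrm{Hom}_T(P,P\otimes_SL)$, $l\mapsto[p\mapsto p\otimes l]$, is an isomorphism; ${}_J\mathcal{L}$ = left $S$-modules $L$ for which $L\to\mathrm{Hom}_S(J,L)$, $l\mapsto[s\mapsto sl]$, is an isomorphism. ${}_TP$ is: $\sum$-self-static if every direct sum $P^{(\Lambda)}$ is $P$-static; a $\ast$-module if $\mathrm{Gen}({}_TP)\approx\mathrm{Cogen}({}_S^{\#}P)$ (equivalence of categories); self-small if $\mathrm{Hom}_T(P,-)$ commutes with direct sums of copies of $P$; $w$-$\sum$-quasi-projective if for every short exact sequence $0\to K\to P^{(\Lambda)}\to V\to0$ of left $T$-modules with $K\in\mathrm{Gen}({}_TP)$ the induced sequence $0\to\mathrm{Hom}_T(P,K)\to\mathrm{Hom}_T(P,P^{(\Lambda)})\to\mathrm{Hom}_T(P,V)\to0$ is exact; self-tilting if it is $w$-$\sum$-quasi-projective and $\mathrm{Gen}({}_TP)=\mathrm{Pres}({}_TP)$.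 *)

(* Defs.v *)
From HB Require Import structures.
From mathcomp Require Import all_boot all_algebra.
From mathcomp Require Import boolp classical_sets functions cardinality.

Set Implicit Arguments.
Unset Strict Implicit.
Unset Printing Implicit Defensive.

Import GRing.Theory.
Local Open Scope classical_set_scope.
Local Open Scope ring_scope.
Local Open Scope quotient_scope.

(* Rings are associative and unital, possibly trivial ([pzRingType]): the
   endomorphism ring of the zero module must be allowed. *)

HB.mixin Record isBimodule (R S : pzRingType) M of GRing.Lmodule R M := {
  ract : M -> S -> M;
  ractDl : forall x y s, ract (x + y) s = ract x s + ract y s;
  ractDr : forall x s t, ract x (s + t) = ract x s + ract x t;
  ractA : forall x s t, ract (ract x s) t = ract x (s * t);
  ract1 : forall x, ract x 1 = x;
  ractZ : forall (r : R) x s, ract (r *: x) s = r *: ract x s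
}.

#[short(type="bimodType")]
HB.structure Definition Bimodule (R S : pzRingType) :=
  {M of isBimodule R S M & GRing.Lmodule R M}.

Notation "x *r s" := (ract x s) (at level 40, left associativity) : ring_scope.

HB.instance Definition _ (R : pzRingType) :=
  isBimodule.Build R R R^o (@mulrDl R) (@mulrDr R)
    (fun x s t => esym (mulrA x s t)) (@mulr1 R)
    (fun r x s => esym (mulrA r x s)).

Record bimod_hom (R S : pzRingType) (A B : bimodType R S) := BimodHom {
  bimod_hom_lin :> {linear A -> B};
  bimod_hom_ract : forall x s, bimod_hom_lin (x *r s) = bimod_hom_lin x *r s
}.

Definition lhom (R : pzRingType) (U V : lmodType R) : Type := {linear U -> V}.

Section LinearHom.
Variables (R : pzRingType) (U V : lmodType R).

Lemma linear_ext (f g : {linear U -> V}) : f =1 g -> f = g.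
Proof.
case: f g => [f [[a1] [b1]]] [g [[a2] [b2]]] /= /funext e.
move: a1 b1 a2 b2; rewrite e => a1 b1 a2 b2.
by rewrite (Prop_irrelevance a1 a2) (Prop_irrelevance b1 b2).
Qed.

HB.instance Definition _ := gen_eqMixin (lhom U V).
HB.instance Definition _ := gen_choiceMixin (lhom U V).

Let add (f g : lhom U V) : lhom U V :=
  ((f : {linear U -> V}) \+ (g : {linear U -> V})).
Let opp (f : lhom U V) : lhom U V := \- (f : {linear U -> V}).
Let zero : lhom U V := \0.

Let addA : associative add.
Proof. by move=> f g h; apply: linear_ext => x /=; rewrite addrA. Qed.
Let addC : commutative add.
Proof. by move=> f g; apply: linear_ext => x /=; rewrite addrC. Qed.
Let add0 : left_id zero add.
Proof. by move=> f; apply: linear_ext => x /=; rewrite add0r. Qed.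
Let addN : left_inverse zero opp add.
Proof. by move=> f; apply: linear_ext => x /=; rewrite addNr. Qed.

HB.instance Definition _ := GRing.isZmodule.Build (lhom U V) addA addC add0 addN.
End LinearHom.

Definition lend (R : pzRingType) (U : lmodType R) : Type := lhom U U.

Section EndRing.
Variables (R : pzRingType) (U : lmodType R).

HB.instance Definition _ := GRing.Zmodule.on (lend U).

Let one : lend U := idfun.
Let mul (f g : lend U) : lend U :=
  ((f : {linear U -> U}) \o (g : {linear U -> U})).

Let mulA : associative mul.
Proof. by move=> f g h; apply: linear_ext. Qed.
Let mul1 : left_id one mul.
Proof. by move=> f; apply: linear_ext. Qed.
Let mulr1 : right_id one mul.
Proof. by move=> f; apply: linear_ext. Qed.
Let mulDl : left_distributive mul +%R.
Proof. by move=> f g h; apply: linear_ext. Qed.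
Let mulDr : right_distributive mul +%R.
Proof. by move=> f g h; apply: linear_ext => x /=; rewrite raddfD. Qed.

HB.instance Definition _ :=
  GRing.Zmodule_isPzRing.Build (lend U) mulA mul1 mulr1 mulDl mulDr.
End EndRing.

(* S = End(_T P)^op; in the converse ring the product [s * t] is [t \o s]. *)
Notation endop P := ((lend P)^c).

(* P as a (T, End(_T P)^op)-bimodule, with p . s = s(p). *)
Definition endmod (T : pzRingType) (P : lmodType T) : Type := P.

Section EndMod.
Variables (T : pzRingType) (P : lmodType T).

HB.instance Definition _ := GRing.Lmodule.on (endmod P).

Let act (x : endmod P) (s : endop P) : endmod P := (s : {linear P -> P}) x.

Let actDl x y s : act (x + y) s = act x s + act y s.
Proof. exact: raddfD. Qed.
Let actDr x s t : act x (s + t) = act x s + act x t.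
Proof. by []. Qed.
Let actA x s t : act (act x s) t = act x (s * t).
Proof. by []. Qed.
Let act1 x : act x 1 = x.
Proof. by []. Qed.
Let actZ (r : T) x s : act (r *: x) s = r *: act x s.
Proof. exact: linearZ. Qed.

HB.instance Definition _ :=
  isBimodule.Build T (endop P) (endmod P) actDl actDr actA act1 actZ.
End EndMod.

(* Left S-module structure of Hom_R(P, K): (s f)(p) = f(p s). *)
Definition HomM (R S : pzRingType) (P : bimodType R S) (K : lmodType R) : Type :=
  lhom P K.

Section HomModule.
Variables (R S : pzRingType) (P : bimodType R S).

Section Def.
Variable K : lmodType R.

HB.instance Definition _ := GRing.Zmodule.on (HomM P K).

Definition hom_fun (f : HomM P K) : {linear P -> K} := f.

Section Scale.
Variables (s : S) (f : HomM P K).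
Definition hom_scale_fun (p : P) : K := hom_fun f (p *r s).
Let hom_scale_linear : linear hom_scale_fun.
Proof. by move=> r x y; rewrite /hom_scale_fun ractDl ractZ linearP. Qed.
HB.instance Definition _ :=
  GRing.isLinear.Build R P K *:%R hom_scale_fun hom_scale_linear.
Definition hom_scale : HomM P K := (hom_scale_fun : {linear P -> K}).
End Scale.

Let scaleA s t f : hom_scale s (hom_scale t f) = hom_scale (s * t) f.
Proof.
by apply: linear_ext => p; rewrite /= /hom_scale_fun /= /hom_scale_fun ractA.
Qed.
Let scale1 : left_id 1 hom_scale.
Proof. by move=> f; apply: linear_ext => p; rewrite /= /hom_scale_fun ract1. Qed.
Let scaleDr : right_distributive hom_scale +%R.
Proof. by move=> s f g; apply: linear_ext. Qed.
Let scaleDl f : {morph hom_scale^~ f : s t / s + t}.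
Proof.
by move=> s t; apply: linear_ext => p; rewrite /= /hom_scale_fun ractDr raddfD.
Qed.

HB.instance Definition _ := GRing.Zmodule_isLmodule.Build S (HomM P K)
  scaleA scale1 scaleDr scaleDl.
End Def.

Section Post.
Variables (K L : lmodType R) (g : {linear K -> L}).
Definition hom_post (f : HomM P K) : HomM P L := (g \o hom_fun f : {linear P -> L}).
Let hom_post_linear : linear hom_post.
Proof. by move=> s f h; apply: linear_ext => p; rewrite /= raddfD. Qed.
HB.instance Definition _ :=
  GRing.isLinear.Build S (HomM P K) (HomM P L) *:%R hom_post hom_post_linear.
End Post.
End HomModule.

Coercion hom_fun : HomM >-> GRing.Linear.type.

(* The free commutative monoid on P * U (lists [:: (p1, u1); ..., (pn, un)],
   standing for the sum of the pi (x) ui) modulo the usual relations. *)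
Section Tensor.
Variables (R S : pzRingType) (P : bimodType R S) (U : lmodType S).

Inductive tens_rel : seq (P * U) -> seq (P * U) -> Prop :=
| tens_refl s : tens_rel s s
| tens_sym s t : tens_rel s t -> tens_rel t s
| tens_trans s t r : tens_rel s t -> tens_rel t r -> tens_rel s r
| tens_cat s t s' t' :
    tens_rel s t -> tens_rel s' t' -> tens_rel (s ++ s') (t ++ t')
| tens_comm s t : tens_rel (s ++ t) (t ++ s)
| tens_zero u : tens_rel [:: (0, u)] [::]
| tens_addl p p' u : tens_rel [:: (p + p', u)] [:: (p, u); (p', u)]
| tens_addr p u u' : tens_rel [:: (p, u + u')] [:: (p, u); (p, u')]
| tens_bal p s u : tens_rel [:: (p *r s, u)] [:: (p, s *: u)].

Definition tens_relb (s t : seq (P * U)) : bool := `[< tens_rel s t >].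

Let relb_refl : reflexive tens_relb.
Proof. by move=> s; apply/asboolP; exact: tens_refl. Qed.
Let relb_sym : symmetric tens_relb.
Proof. by move=> s t; apply/asboolP/asboolP; exact: tens_sym. Qed.
Let relb_trans : transitive tens_relb.
Proof.
by move=> s t r /asboolP st /asboolP sr; apply/asboolP; exact: tens_trans sr.
Qed.

Canonical tens_equiv := EquivRel tens_relb relb_refl relb_sym relb_trans.

Definition tens : Type := {eq_quot tens_equiv}.

HB.instance Definition _ := Choice.on tens.
HB.instance Definition _ : EqQuotient _ tens_equiv tens := EqQuotient.on tens.

Lemma tensP s t : tens_rel s t <-> \pi_tens s = \pi_tens t.
Proof.
by split=> [st|/eqmodP/asboolP //]; apply/eqmodP/asboolP.
Qed.

Lemma tens_repr z : \pi_tens (repr z) = z.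
Proof. exact: reprK. Qed.

Lemma tens_repr_pi s : tens_rel (repr (\pi_tens s)) s.
Proof. by apply/tensP; rewrite tens_repr. Qed.

Definition tens_mk (p : P) (u : U) : tens := \pi_tens [:: (p, u)].

Section MapL.
Variable phi : P -> P.
Hypothesis phiD : {morph phi : x y / x + y}.
Hypothesis phiR : forall x s, phi (x *r s) = phi x *r s.

Lemma tens_rel_mapl s t : tens_rel s t ->
  tens_rel [seq (phi x.1, x.2) | x <- s] [seq (phi x.1, x.2) | x <- t].
Proof.
have phi0 : phi 0 = 0 by apply: (addrI (phi 0)); rewrite -phiD !addr0.
elim=> /= *; rewrite ?map_cat ?phi0 ?phiD ?phiR.
- exact: tens_refl.
- exact: tens_sym.
- by apply: tens_trans; eassumption.
- exact: tens_cat.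
- exact: tens_comm.
- exact: tens_zero.
- exact: tens_addl.
- exact: tens_addr.
- exact: tens_bal.
Qed.
End MapL.

Let add (z w : tens) : tens := \pi_tens (repr z ++ repr w).
Let opp (z : tens) : tens := \pi_tens [seq (- x.1, x.2) | x <- repr z].
Let zero : tens := \pi_tens [::].
Let scale (r : R) (z : tens) : tens := \pi_tens [seq (r *: x.1, x.2) | x <- repr z].

Let addE s t : add (\pi_tens s) (\pi_tens t) = \pi_tens (s ++ t).
Proof. by apply/tensP/tens_cat; exact: tens_repr_pi. Qed.
Let ractN (x : P) (s : S) : (- x) *r s = - (x *r s).
Proof. by rewrite -[in LHS]scaleN1r ractZ scaleN1r. Qed.
Let oppE s : opp (\pi_tens s) = \pi_tens [seq (- x.1, x.2) | x <- s].
Proof.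
apply/tensP/(@tens_rel_mapl -%R); last exact: tens_repr_pi.
  exact: opprD.
by move=> x t; rewrite ractN.
Qed.
Let scaleE r s : scale r (\pi_tens s) = \pi_tens [seq (r *: x.1, x.2) | x <- s].
Proof.
apply/tensP/(@tens_rel_mapl ( *:%R r)); last exact: tens_repr_pi.
  exact: scalerDr.
by move=> x t; rewrite ractZ.
Qed.

Let addA : associative add.
Proof.
move=> x y z; rewrite -[x]tens_repr -[y]tens_repr -[z]tens_repr.
by rewrite !addE catA.
Qed.
Let addC : commutative add.
Proof.
move=> x y; rewrite -[x]tens_repr -[y]tens_repr !addE; apply/tensP.
exact: tens_comm.
Qed.
Let add0 : left_id zero add.
Proof. by move=> x; rewrite -[x]tens_repr addE. Qed.
Let addN : left_inverse zero opp add.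
Proof.
have consE a s : \pi_tens (a :: s) = add (\pi_tens [:: a]) (\pi_tens s).
  by rewrite addE.
have oppK1 p u : add (\pi_tens [:: (- p, u)]) (\pi_tens [:: (p, u)]) = zero.
  rewrite addE; apply/tensP.
  apply: tens_trans (tens_sym (tens_addl _ _ _)) _; rewrite addNr.
  exact: tens_zero.
move=> x; rewrite -[x]tens_repr oppE; elim: (repr x) => [|[p u] s IHs] /=.
  by rewrite addE.
rewrite (consE (- p, u)) (consE (p, u)) -addA.
rewrite [X in add _ X]addA [X in add _ (add X _)]addC -addA IHs addA oppK1.
exact: add0.
Qed.

HB.instance Definition _ := GRing.isZmodule.Build tens addA addC add0 addN.

Lemma tens_addE s t : \pi_tens (s ++ t) = \pi_tens s + \pi_tens t :> tens.
Proof. by rewrite -addE. Qed.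

Lemma tens_piE s : \pi_tens s = \sum_(x <- s) tens_mk x.1 x.2 :> tens.
Proof.
elim: s => [|[p u] s IHs]; first by rewrite big_nil.
by rewrite big_cons -IHs -tens_addE.
Qed.

Lemma tens_ind (X : tens -> Prop) :
  X 0 -> (forall z w, X z -> X w -> X (z + w)) ->
  (forall p u, X (tens_mk p u)) -> forall z, X z.
Proof.
move=> X0 XD Xm z; rewrite -[z]tens_repr tens_piE.
by apply: big_ind => // x _; exact: Xm.
Qed.

Lemma tens_mkDl p p' u : tens_mk (p + p') u = tens_mk p u + tens_mk p' u.
Proof. by rewrite -tens_addE; apply/tensP; exact: tens_addl. Qed.

Lemma tens_mkDr p u u' : tens_mk p (u + u') = tens_mk p u + tens_mk p u'.
Proof. by rewrite -tens_addE; apply/tensP; exact: tens_addr. Qed.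

Lemma tens_mk_bal p s u : tens_mk (p *r s) u = tens_mk p (s *: u).
Proof. by apply/tensP; exact: tens_bal. Qed.

Let scaleA r r' z : scale r (scale r' z) = scale (r * r') z.
Proof.
rewrite -[z]tens_repr !scaleE -map_comp; congr (\pi_tens _).
by apply: eq_map => x /=; rewrite scalerA.
Qed.
Let scale1 : left_id 1 scale.
Proof.
move=> z; rewrite -[z]tens_repr scaleE; congr (\pi_tens _).
by rewrite -[RHS]map_id; apply: eq_map => -[p u] /=; rewrite scale1r.
Qed.
Let scaleDr : right_distributive scale +%R.
Proof.
move=> r z w; rewrite -[z]tens_repr -[w]tens_repr -tens_addE !scaleE.
by rewrite -tens_addE map_cat.
Qed.
Let scaleDl z : {morph scale^~ z : r r' / r + r'}.
Proof.
move=> r r'; elim/tens_ind: z => [|z w IHz IHw|p u].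
- by rewrite /GRing.zero /= !scaleE /= -[RHS]/(add _ _) addE.
- by rewrite !scaleDr IHz IHw addrACA.
by rewrite !scaleE /= scalerDl -tens_mkDl.
Qed.

HB.instance Definition _ := GRing.Zmodule_isLmodule.Build R tens
  scaleA scale1 scaleDr scaleDl.

Lemma tens_mkZ r p u : r *: tens_mk p u = tens_mk (r *: p) u.
Proof. exact: scaleE. Qed.

(* [tens_lift b] is defined for every [b], but it sends p (x) u to [b p u] only
   when [b] is balanced (lemma [tens_lift_mk]). *)
Definition balanced (A : zmodType) (b : P -> U -> A) : Prop :=
  [/\ forall p p' u, b (p + p') u = b p u + b p' u,
      forall p u u', b p (u + u') = b p u + b p u' &
      forall p s u, b (p *r s) u = b p (s *: u)].

Definition tens_lift (A : zmodType) (b : P -> U -> A) (z : tens) : A :=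
  \sum_(x <- repr z) b x.1 x.2.

Section Lift.
Variables (A : zmodType) (b : P -> U -> A).
Hypothesis balb : balanced b.

Lemma tens_rel_lift s t : tens_rel s t ->
  \sum_(x <- s) b x.1 x.2 = \sum_(x <- t) b x.1 x.2.
Proof.
case: balb => bDl bDr bS.
have b0 u : b 0 u = 0 by apply: (addrI (b 0 u)); rewrite -bDl !addr0.
elim=> {s t} //= *; rewrite ?big_cat ?big_cons ?big_nil /= ?addr0 //.
- by etransitivity; eassumption.
- by congr (_ + _).
- by rewrite addrC.
Qed.

Lemma tens_lift_pi s : tens_lift b (\pi_tens s) = \sum_(x <- s) b x.1 x.2.
Proof. exact/tens_rel_lift/tens_repr_pi. Qed.

Lemma tens_lift_mk p u : tens_lift b (tens_mk p u) = b p u.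
Proof. by rewrite tens_lift_pi big_seq1. Qed.

Lemma tens_liftD z w : tens_lift b (z + w) = tens_lift b z + tens_lift b w.
Proof.
by rewrite -[z]tens_repr -[w]tens_repr -tens_addE !tens_lift_pi big_cat.
Qed.

Lemma tens_lift0 : tens_lift b 0 = 0.
Proof. by apply: (addrI (tens_lift b 0)); rewrite -tens_liftD !addr0. Qed.

Lemma tens_lift_uniq (f : tens -> A) :
  {morph f : z w / z + w} -> (forall p u, f (tens_mk p u) = b p u) ->
  f =1 tens_lift b.
Proof.
move=> fD fb; elim/tens_ind => [|z w IHz IHw|p u].
- by rewrite tens_lift0; apply: (addrI (f 0)); rewrite -fD !addr0.
- by rewrite fD tens_liftD IHz IHw.
by rewrite fb tens_lift_mk.
Qed.
End Lift.

Lemma tens_lift_linear (A : lmodType R) (b : P -> U -> A) : balanced b ->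
  (forall r p u, b (r *: p) u = r *: b p u) -> linear (tens_lift b).
Proof.
move=> balb bZ r z w; rewrite (tens_liftD balb); congr (_ + _).
elim/tens_ind: z => [|x y IHx IHy|p u].
- by rewrite !(scaler0, tens_lift0 balb).
- by rewrite scalerDr !(tens_liftD balb) IHx IHy scalerDr.
by rewrite tens_mkZ !(tens_lift_mk balb).
Qed.
End Tensor.

Notation "p ⊗ u" := (tens_mk p u) (at level 40, left associativity) : ring_scope.

Section TensorBimodule.
Variables (R S R' : pzRingType) (P : bimodType R S) (Q : bimodType S R').

Let act_fun (t : R') (p : P) (q : Q) : tens P Q := p ⊗ (q *r t).
Let act_bal t : balanced (act_fun t).
Proof.
split=> [p p' q|p q q'|p s q]; rewrite /act_fun.
- exact: tens_mkDl.
- by rewrite ractDl tens_mkDr.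
by rewrite tens_mk_bal ractZ.
Qed.

Definition tens_ract (z : tens P Q) (t : R') : tens P Q :=
  tens_lift (fun p q => p ⊗ (q *r t)) z.

Lemma tens_ract_mk p q t : tens_ract (p ⊗ q) t = p ⊗ (q *r t).
Proof. exact: (tens_lift_mk (act_bal t)). Qed.

Let ractDl' x y t : tens_ract (x + y) t = tens_ract x t + tens_ract y t.
Proof. exact: (tens_liftD (act_bal t)). Qed.
Let ract0 t : tens_ract 0 t = 0.
Proof. exact: (tens_lift0 (act_bal t)). Qed.
Let ractDr' x t t' : tens_ract x (t + t') = tens_ract x t + tens_ract x t'.
Proof.
elim/tens_ind: x => [|x y IHx IHy|p q]; first by rewrite !ract0 addr0.
  by rewrite !ractDl' IHx IHy addrACA.
by rewrite !tens_ract_mk ractDr tens_mkDr.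
Qed.
Let ractA' x t t' : tens_ract (tens_ract x t) t' = tens_ract x (t * t').
Proof.
elim/tens_ind: x => [|x y IHx IHy|p q]; first by rewrite !ract0.
  by rewrite !ractDl' IHx IHy.
by rewrite !tens_ract_mk ractA.
Qed.
Let ract1' x : tens_ract x 1 = x.
Proof.
elim/tens_ind: x => [|x y IHx IHy|p q]; first by rewrite !ract0.
  by rewrite ractDl' IHx IHy.
by rewrite tens_ract_mk ract1.
Qed.
Let ractZ' (r : R) x t : tens_ract (r *: x) t = r *: tens_ract x t.
Proof.
elim/tens_ind: x => [|x y IHx IHy|p q]; first by rewrite scaler0 ract0 scaler0.
  by rewrite scalerDr !ractDl' IHx IHy scalerDr.
by rewrite tens_mkZ !tens_ract_mk tens_mkZ.
Qed.

HB.instance Definition _ := isBimodule.Build R R' (tens P Q)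
  ractDl' ractDr' ractA' ract1' ractZ'.

Lemma tens_mk_ract p q t : (p ⊗ q) *r t = p ⊗ (q *r t).
Proof. exact: tens_ract_mk. Qed.
End TensorBimodule.

Section Static.
Variables (R S : pzRingType) (P : bimodType R S).

Section Eval.
Variable K : lmodType R.

Definition tens_eval : tens P (HomM P K) -> K :=
  tens_lift (fun p (f : HomM P K) => f p).

Lemma eval_balanced : balanced (fun p (f : HomM P K) => f p).
Proof. by split=> // p p' f; rewrite raddfD. Qed.

Lemma tens_eval_linear : linear tens_eval.
Proof. by apply: (tens_lift_linear eval_balanced) => r p f; rewrite linearZ. Qed.

HB.instance Definition _ := GRing.isLinear.Build R (tens P (HomM P K)) K *:%R
  tens_eval tens_eval_linear.
End Eval.

Section Coeval.
Variable L : lmodType S.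

Definition coeval_fun (l : L) (p : P) : tens P L := p ⊗ l.
Let coeval_fun_linear l : linear (coeval_fun l).
Proof. by move=> r x y; rewrite /coeval_fun tens_mkDl tens_mkZ. Qed.
HB.instance Definition _ l := GRing.isLinear.Build R P (tens P L) *:%R
  (coeval_fun l) (@coeval_fun_linear l).

Definition tens_coeval (l : L) : HomM P (tens P L) :=
  (coeval_fun l : {linear P -> tens P L}).
Let tens_coeval_linear : linear tens_coeval.
Proof.
move=> s x y; apply: linear_ext => p; rewrite /= /coeval_fun /hom_scale_fun /=.
by rewrite /coeval_fun tens_mkDr tens_mk_bal.
Qed.
HB.instance Definition _ := GRing.isLinear.Build S L (HomM P (tens P L)) *:%R
  tens_coeval tens_coeval_linear.
End Coeval.
End Static.

Definition modclass (R : pzRingType) := lmodType R -> Prop.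

Definition Stat (R S : pzRingType) (P : bimodType R S) : modclass R :=
  fun K => bijective (@tens_eval R S P K).

Definition Adstat (R S : pzRingType) (P : bimodType R S) : modclass S :=
  fun L => bijective (@tens_coeval R S P L).

Record morita_context (T S : pzRingType) (P : bimodType T S)
    (Q : bimodType S T) := MoritaContext {
  mc_T : bimod_hom (tens P Q) T^o;
  mc_S : bimod_hom (tens Q P) S^o;
  mc_assocQ : forall (q : Q) (p : P) (q' : Q),
    (mc_S (q ⊗ p) : S) *: q' = q *r (mc_T (p ⊗ q') : T);
  mc_assocP : forall (p : P) (q : Q) (p' : P),
    p *r (mc_S (q ⊗ p') : S) = (mc_T (p ⊗ q) : T) *: p'
}.

Section Alpha.
Variables (T S : pzRingType) (P : bimodType T S) (Q : bimodType S T).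
Variable b : bimod_hom (tens Q P) S^o.
Variable U : lmodType S.

Definition alpha_fun (p : P) (u : U) (q : Q) : U := (b (q ⊗ p) : S) *: u.
Let alpha_fun_linear p u : linear (alpha_fun p u).
Proof.
move=> s x y; rewrite /alpha_fun tens_mkDl -tens_mkZ linearP scalerDl scalerA.
by [].
Qed.
HB.instance Definition _ p u :=
  GRing.isLinear.Build S Q U *:%R (alpha_fun p u) (@alpha_fun_linear p u).

Definition alpha_hom (p : P) (u : U) : HomM Q U :=
  (alpha_fun p u : {linear Q -> U}).

Lemma alpha_balanced : balanced alpha_hom.
Proof.
split=> [p p' u|p u u'|p s u]; apply: linear_ext => q; rewrite /= /alpha_fun.
- by rewrite tens_mkDr raddfD scalerDl.
- by rewrite scalerDr.
by rewrite -tens_mk_ract bimod_hom_ract scalerA.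
Qed.

Definition alpha_map : tens P U -> HomM Q U := tens_lift alpha_hom.

Lemma alpha_map_linear : linear alpha_map.
Proof.
apply: (tens_lift_linear alpha_balanced) => t p u; apply: linear_ext => q.
by rewrite /= /hom_scale_fun /= /alpha_fun tens_mk_bal.
Qed.

HB.instance Definition _ := GRing.isLinear.Build T (tens P U) (HomM Q U) *:%R
  alpha_map alpha_map_linear.
End Alpha.

Definition alpha_cond (T S : pzRingType) (P : bimodType T S)
    (Q : bimodType S T) (b : bimod_hom (tens Q P) S^o) : Prop :=
  forall U : lmodType S, injective (@alpha_map T S P Q b U).

(* (Q, P_S) satisfies the right alpha-condition over S. *)
Definition alphaP (T S : pzRingType) (P : bimodType T S) (Q : bimodType S T)
    (M : morita_context P Q) : Prop := alpha_cond (mc_S M).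

(* (P, Q_T) satisfies the right alpha-condition over T. *)
Definition alphaQ (T S : pzRingType) (P : bimodType T S) (Q : bimodType S T)
    (M : morita_context P Q) : Prop := alpha_cond (mc_T M).

Definition right_alpha (T S : pzRingType) (P : bimodType T S)
    (Q : bimodType S T) (M : morita_context P Q) : Prop :=
  alphaP M /\ alphaQ M.

Section Image.
Variables (R S : pzRingType) (A B : bimodType R S) (f : bimod_hom A B).

Definition img_pred : {pred B} := fun y => `[< exists x, f x = y >].

Lemma img_predP y : reflect (exists x, f x = y) (y \in img_pred).
Proof. exact: asboolP. Qed.

Let img_submod : submod_closed img_pred.
Proof.
split=> [|r _ _ /img_predP[x <-] /img_predP[y <-]]; apply/img_predP.
  by exists 0; rewrite raddf0.
by exists (r *: x + y); rewrite linearP.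
Qed.
HB.instance Definition _ :=
  GRing.isSubmodClosed.Build R B img_pred img_submod.

Record bimod_img : Type := BimodImg {img_val : B; _ : img_val \in img_pred}.
HB.instance Definition _ := [isSub for img_val].
HB.instance Definition _ := [Choice of bimod_img by <:].
HB.instance Definition _ := [SubChoice_isSubLmodule of bimod_img by <:].

Let img_ract_in (x : bimod_img) (s : S) : val x *r s \in img_pred.
Proof.
case: x => _ /= /img_predP[x <-]; apply/img_predP.
by exists (x *r s); rewrite bimod_hom_ract.
Qed.
Let act (x : bimod_img) (s : S) : bimod_img := BimodImg (img_ract_in x s).

Let actDl x y s : act (x + y) s = act x s + act y s.
Proof. by apply: val_inj; exact: ractDl. Qed.
Let actDr x s t : act x (s + t) = act x s + act x t.
Proof. by apply: val_inj; exact: ractDr. Qed.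
Let actA x s t : act (act x s) t = act x (s * t).
Proof. by apply: val_inj; exact: ractA. Qed.
Let act1 x : act x 1 = x.
Proof. by apply: val_inj; exact: ract1. Qed.
Let actZ (r : R) x s : act (r *: x) s = r *: act x s.
Proof. by apply: val_inj; exact: ractZ. Qed.
HB.instance Definition _ :=
  isBimodule.Build R S bimod_img actDl actDr actA act1 actZ.
End Image.

Section IdealHom.
Variables (S : pzRingType) (A : bimodType S S) (f : bimod_hom A S^o).
Variable L : lmodType S.

Definition smul_fun (l : L) (j : bimod_img f) : L := (img_val j : S) *: l.
Let smul_fun_linear l : linear (smul_fun l).
Proof.
move=> s x y; rewrite /smul_fun scalerA -scalerDl; congr (_ *: l).
Qed.
HB.instance Definition _ l := GRing.isLinear.Build S (bimod_img f) L *:%R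
  (smul_fun l) (@smul_fun_linear l).

Definition smul_hom (l : L) : HomM (bimod_img f) L :=
  (smul_fun l : {linear bimod_img f -> L}).
Let smul_hom_linear : linear smul_hom.
Proof.
move=> s x y; apply: linear_ext => j.
rewrite /= /smul_fun /hom_scale_fun /= /smul_fun /=.
by rewrite scalerDr scalerA.
Qed.
HB.instance Definition _ := GRing.isLinear.Build S L (HomM (bimod_img f) L) *:%R
  smul_hom smul_hom_linear.
End IdealHom.

(* The class _J L for the two-sided ideal J = Im(f) of S. *)
Definition ideal_class (S : pzRingType) (A : bimodType S S)
    (f : bimod_hom A S^o) : modclass S :=
  fun L => bijective (@smul_hom S A f L).

Section DirectSum.
Variables (R : pzRingType) (I : Type) (U : lmodType R).

Definition fin_supp : {pred I -> U} :=
  fun x => `[< finite_set [set i | x i <> 0] >].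

Let fin_supp_submod : submod_closed fin_supp.
Proof.
split=> [|r x y /asboolP fx /asboolP fy]; apply/asboolP.
  rewrite (_ : [set _ | _] = set0); first exact: finite_set0.
  by apply/seteqP; split=> i.
have : finite_set ([set i | x i <> 0] `|` [set i | y i <> 0]).
  by rewrite finite_setU.
apply: sub_finite_set => i /= xy0.
have [x0|] := pselect (x i = 0); last by left.
by right=> y0; apply: xy0; rewrite -[LHS]/(r *: x i + y i) x0 y0 scaler0 addr0.
Qed.
HB.instance Definition _ :=
  GRing.isSubmodClosed.Build R (I -> U) fin_supp fin_supp_submod.

Record dsum : Type := DSum {dsum_val :> I -> U; _ : dsum_val \in fin_supp}.
HB.instance Definition _ := [isSub for dsum_val].
HB.instance Definition _ := [Choice of dsum by <:].
HB.instance Definition _ := [SubChoice_isSubLmodule of dsum by <:].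
End DirectSum.

Definition surjective (A B : Type) (f : A -> B) : Prop := forall y, exists x, f x = y.

Definition exact_at (R : pzRingType) (A B C : lmodType R)
    (f : {linear A -> B}) (g : {linear B -> C}) : Prop :=
  forall y, g y = 0 <-> exists x, f x = y.

Definition short_exact (R : pzRingType) (A B C : lmodType R)
    (f : {linear A -> B}) (g : {linear B -> C}) : Prop :=
  [/\ injective f, exact_at f g & surjective g].

Section Classes.
Variables (R : pzRingType) (U : lmodType R).

Definition Gen : modclass R := fun V =>
  exists (I : Type) (g : {linear dsum I U -> V}), surjective g.

Definition Pres : modclass R := fun V =>
  exists (I1 I2 : Type) (f : {linear dsum I2 U -> dsum I1 U})
    (g : {linear dsum I1 U -> V}), exact_at f g /\ surjective g.

(* The product U^I is the module [I -> U] of all functions. *)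
Definition Cogen : modclass R := fun V =>
  exists (I : Type) (f : {linear V -> (I -> U)}), injective f.

Definition Copres : modclass R := fun W =>
  exists (I1 I2 : Type) (f : {linear W -> (I1 -> U)})
    (g : {linear (I1 -> U) -> (I2 -> U)}), injective f /\ exact_at f g.
End Classes.

Definition same_class (R : pzRingType) (C D : modclass R) : Prop :=
  forall V, C V <-> D V.

Definition factor_closed (R : pzRingType) (C : modclass R) : Prop :=
  forall (K V : lmodType R) (g : {linear K -> V}), surjective g -> C K -> C V.

Definition injective_module (R : pzRingType) (E : lmodType R) : Prop :=
  forall (A B : lmodType R) (i : {linear A -> B}) (f : {linear A -> E}),
    injective i -> exists g : {linear B -> E}, forall x, g (i x) = f x.

Definition cogenerator (R : pzRingType) (E : lmodType R) : Prop :=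
  forall V : lmodType R, Cogen E V.

Record category := Category {
  obj : Type;
  mor : obj -> obj -> Type;
  idm : forall X, mor X X;
  compm : forall X Y Z, mor Y Z -> mor X Y -> mor X Z;
  comp1m : forall X Y (f : mor X Y), compm (idm Y) f = f;
  compm1 : forall X Y (f : mor X Y), compm f (idm X) = f;
  compmA : forall X Y Z W (h : mor Z W) (g : mor Y Z) (f : mor X Y),
    compm h (compm g f) = compm (compm h g) f
}.

Record cfunctor (C D : category) := CFunctor {
  fobj :> obj C -> obj D;
  fmor : forall X Y, mor X Y -> mor (fobj X) (fobj Y);
  fmor1 : forall X, fmor (idm X) = idm (fobj X);
  fmorM : forall X Y Z (g : mor Y Z) (f : mor X Y),
    fmor (compm g f) = compm (fmor g) (fmor f)
}.

Definition cfunctor_id (C : category) : cfunctor C C :=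
  @CFunctor C C id (fun _ _ f => f) (fun _ => erefl) (fun _ _ _ _ _ => erefl).

Program Definition cfunctor_comp (C D E : category) (G : cfunctor D E)
    (F : cfunctor C D) : cfunctor C E :=
  @CFunctor C E (G \o F) (fun _ _ f => fmor G (fmor F f)) _ _.
Next Obligation. by rewrite !fmor1. Qed.
Next Obligation. by rewrite !fmorM. Qed.

Definition isomorphism (C : category) (X Y : obj C) (f : mor X Y) : Prop :=
  exists g : mor Y X, compm g f = idm X /\ compm f g = idm Y.

Definition nat_iso (C D : category) (F G : cfunctor C D) : Prop :=
  exists eta : forall X, mor (F X) (G X),
    (forall X, isomorphism (eta X)) /\
    (forall X Y (f : mor X Y), compm (eta Y) (fmor F f) = compm (fmor G f) (eta X)).

Definition equivalent (C D : category) : Prop :=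
  exists (F : cfunctor C D) (G : cfunctor D C),
    nat_iso (cfunctor_comp G F) (cfunctor_id C) /\
    nat_iso (cfunctor_comp F G) (cfunctor_id D).

Section FullSubcategory.
Variables (R : pzRingType) (C : modclass R).
Implicit Types X Y Z : {V : lmodType R | C V}.

Let mor X Y : Type := {linear sval X -> sval Y}.
Let one X : mor X X := idfun.
Let comp X Y Z (g : mor Y Z) (f : mor X Y) : mor X Z :=
  (g : {linear _ -> _}) \o (f : {linear _ -> _}).
Let comp1 X Y (f : mor X Y) : comp (one Y) f = f.
Proof. exact: linear_ext. Qed.
Let comp1' X Y (f : mor X Y) : comp f (one X) = f.
Proof. exact: linear_ext. Qed.
Let compA X Y Z W (h : mor Z W) (g : mor Y Z) (f : mor X Y) :
  comp h (comp g f) = comp (comp h g) f.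
Proof. exact: linear_ext. Qed.

Definition full_subcat : category := Category comp1 comp1' compA.
End FullSubcategory.

Section Properties.
Variables (T : pzRingType) (P : lmodType T).

Definition dualmod (E : lmodType T) : Type := HomM (endmod P) E.
HB.instance Definition _ E := GRing.Lmodule.on (dualmod E).

Definition sum_self_static : Prop :=
  forall I : Type, Stat (endmod P) (dsum I P).

Definition star_module (E : lmodType T) : Prop :=
  equivalent (full_subcat (Gen P)) (full_subcat (Cogen (dualmod E))).

Section SelfSmall.
Variable I : Type.
Implicit Type f : dsum I (HomM (endmod P) P).

Lemma sum_hom_fin_supp f (p : P) :
  (fun i => hom_fun (f i) p) \in @fin_supp T I P.
Proof.
case: f => f /= /asboolP ff; apply/asboolP; apply: sub_finite_set ff => i /=.
by apply: contra_not => ->.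
Qed.

Definition sum_hom_fun f (p : endmod P) : dsum I P := DSum (sum_hom_fin_supp f p).
Let sum_hom_fun_linear f : linear (sum_hom_fun f).
Proof.
move=> t x y; apply: val_inj; apply/funext => i /=.
by rewrite linearP.
Qed.
HB.instance Definition _ f :=
  GRing.isLinear.Build T (endmod P) (dsum I P) *:%R (sum_hom_fun f)
    (@sum_hom_fun_linear f).

Definition sum_hom f : HomM (endmod P) (dsum I P) :=
  (sum_hom_fun f : {linear endmod P -> dsum I P}).
End SelfSmall.

Definition self_small : Prop := forall I : Type, bijective (@sum_hom I).

Definition w_sum_quasi_projective : Prop :=
  forall (I : Type) (K V : lmodType T)
    (i : {linear K -> dsum I P}) (g : {linear dsum I P -> V}),
    short_exact i g -> Gen P K ->
    short_exact (@hom_post _ _ (endmod P) _ _ i) (@hom_post _ _ (endmod P) _ _ g).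

Definition self_tilting : Prop :=
  w_sum_quasi_projective /\ same_class (Gen P) (Pres P).
End Properties.

(* Main.v *)
Require Import Defs.
From HB Require Import structures.
From mathcomp Require Import all_boot all_algebra.
From mathcomp Require Import boolp classical_sets functions cardinality fsbigop.
Import GRing.Theory.
Local Open Scope ring_scope.

Set Implicit Arguments.
Unset Strict Implicit.
Unset Printing Implicit Defensive.

(** Write alpha : P ⊗ U -> Hom_S(Q, U) for the map of the alpha-condition.  The
    Morita identities give p ⊗ alpha(z)(q) = <p,q>_T z in P ⊗ U.  If alpha is
    injective for all U, this makes every evaluation P ⊗ Hom(P,K) -> K injective,
    so that static means generated, and it makes P flat over S.  An element of
    the kernel of the cover P^(Hom(P,V)) -> V then vanishes in P ⊗ Hom(P,V), hence
    comes from maps P -> kernel, so Gen = Pres.  Every Hom(P,K) is adstatic and,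
    by flatness, so are kernels of maps between adstatic modules; this gives the
    equivalence with Copres.

    When Cogen(#P) lies in _J L, a map f : P -> P ⊗ L with L cogenerated by #P
    satisfies j f = coeval(psi j) for some linear psi : J -> L; psi is
    multiplication by some l, and alpha kills f - coeval l, so L is adstatic.
    Quasi-projectivity and self-smallness both follow from one fact: if
    j : C -> Hom(P,V) is injective, C is adstatic and the images of the maps j(c)
    span V, then P ⊗ C = V, and hence j is onto. *)

(** * Linear maps, images and cokernels *)

Section MakeLinear.
Variables (R : pzRingType) (U V : lmodType R) (f : U -> V).
Hypothesis lin_f : linear f.

Lemma mklin_subproof : {g : {linear U -> V} | g =1 f}.
Proof.
pose F : {linear U -> V} :=
  HB.pack f (GRing.isLinear.Build R U V *:%R f lin_f).
by exists F.
Qed.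

(* Sealed behind an opaque proof, so that simplification does not unfold the maps
   built with it. *)
Definition mklin : {linear U -> V} := sval mklin_subproof.

Lemma mklinE : mklin =1 f.
Proof. exact: svalP mklin_subproof. Qed.
End MakeLinear.

Section Quotients.
Variables (R : pzRingType) (A B : lmodType R) (f : {linear A -> B}).

Definition range_pred : {pred B} := fun y => `[< exists x, f x = y >].

Lemma range_predP y : reflect (exists x, f x = y) (y \in range_pred).
Proof. exact: asboolP. Qed.

Let range_submod : submod_closed range_pred.
Proof.
split=> [|r _ _ /range_predP[x <-] /range_predP[y <-]]; apply/range_predP.
  by exists 0; rewrite raddf0.
by exists (r *: x + y); rewrite linearP.
Qed.
HB.instance Definition _ :=
  GRing.isSubmodClosed.Build R B range_pred range_submod.

Record range_mod : Type :=
  RangeMod {range_val : B; _ : range_val \in range_pred}.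
HB.instance Definition _ := [isSub for range_val].
HB.instance Definition _ := [Choice of range_mod by <:].
HB.instance Definition _ := [SubChoice_isSubLmodule of range_mod by <:].

Lemma image_factorization : exists (C : lmodType R) (e : {linear A -> C})
  (i : {linear C -> B}), [/\ surjective e, injective i & forall x, i (e x) = f x].
Proof.
pose e0 x : range_mod := RangeMod (introT (range_predP (f x)) (ex_intro _ x erefl)).
have lin_e : linear e0 by move=> r x y; apply: val_inj; rewrite /= linearP.
exists range_mod, (mklin lin_e), (val : {linear range_mod -> B}).
split=> [[y hy]||x]; last by rewrite mklinE.
  have /range_predP[x xy] := hy.
  by exists x; apply: val_inj; rewrite mklinE.
exact: val_inj.
Qed.

Definition coker : Type := Quotient.quot range_pred.
HB.instance Definition _ := GRing.Zmodule.on coker.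

Let pi (y : B) : coker := (\pi_(Quotient.quot range_pred) y)%qT.

Let piP x y : reflect (pi x = pi y) (x - y \in range_pred).
Proof. by rewrite Quotient.idealrBE; apply: eqP. Qed.

Let piD : {morph pi : x y / x + y}.
Proof. exact: (raddfD (\pi_(Quotient.quot range_pred))%qT). Qed.

Let piK (z : coker) : pi (repr z) = z.
Proof. exact: reprK. Qed.

Let scale (r : R) (z : coker) : coker := pi (r *: repr z).

Let scaleE r y : scale r (pi y) = pi (r *: y).
Proof. by apply/piP; rewrite -scalerBr rpredZ //; apply/piP; rewrite piK. Qed.

Let scaleA r s z : scale r (scale s z) = scale (r * s) z.
Proof. by rewrite -[z]piK !scaleE scalerA. Qed.
Let scale1 : left_id 1 scale.
Proof. by move=> z; rewrite -[z]piK scaleE scale1r. Qed.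
Let scaleDr : right_distributive scale +%R.
Proof. by move=> r x y; rewrite -[x]piK -[y]piK -piD !scaleE scalerDr piD. Qed.
Let scaleDl z : {morph scale^~ z : r s / r + s}.
Proof. by move=> r s; rewrite -[z]piK !scaleE scalerDl piD. Qed.

HB.instance Definition _ := GRing.Zmodule_isLmodule.Build R coker
  scaleA scale1 scaleDr scaleDl.

(** Embedding this cokernel in a power of E gives the second map of a copresentation. *)
Lemma coker_exists : exists (C : lmodType R) (g : {linear B -> C}), exact_at f g.
Proof.
have lin_pi : linear pi by move=> r x y; rewrite piD -scaleE.
exists coker, (mklin lin_pi) => y; split.
  move=> h; apply/range_predP; rewrite -[y]subr0; apply/(piP y 0).
  by rewrite -!(mklinE lin_pi) h raddf0.
move=> hy; have h : pi y = pi 0 by apply/piP; rewrite subr0; exact/range_predP.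
by rewrite mklinE h -(mklinE lin_pi) raddf0.
Qed.
End Quotients.

(** * Direct sums and maps out of them *)

Section DsumTheory.
Variables (R : pzRingType) (I : Type) (U : lmodType R).
Implicit Types (x y : dsum I U).

(** Indices are taken in [{classic I}] because finitely supported sums need a choice structure on
    the index type. *)
Definition supp x : set {classic I} := [set i | x i <> 0]%classic.

Lemma supp_finite x : finite_set (supp x).
Proof. by case: x => x hx; exact/asboolP. Qed.

Lemma dsumP x y : (forall i, x i = y i) -> x = y.
Proof. by move=> xy; apply: val_inj; apply: funext. Qed.

Lemma dsumD x y i : (x + y : dsum I U) i = x i + y i.
Proof. by []. Qed.
Lemma dsumZ r x i : (r *: x : dsum I U) i = r *: x i.
Proof. by []. Qed.

Definition inj_fun (i : I) (u : U) (j : I) : U :=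
  if `[< i = j >] then u else 0.

Lemma inj_fun_supp i u : inj_fun i u \in @fin_supp R I U.
Proof.
apply/asboolP; apply: (@sub_finite_set _ _ [set i]%classic); last exact: finite_set1.
by move=> j /=; rewrite /inj_fun; case: asboolP.
Qed.

Lemma inj_linear i : linear (fun u => DSum (inj_fun_supp i u) : dsum I U).
Proof.
move=> r x y; apply: dsumP => j; rewrite dsumD dsumZ /= /inj_fun.
by case: asboolP => ij; rewrite ?scaler0 ?addr0.
Qed.

Definition dsum_inj i : {linear U -> dsum I U} := mklin (inj_linear i).

Lemma dsum_inj_same i u : dsum_inj i u i = u.
Proof. by rewrite mklinE /= /inj_fun; case: asboolP. Qed.

Lemma dsum_inj_diff i j u : i <> j -> dsum_inj i u j = 0.
Proof. by rewrite mklinE /= /inj_fun; case: asboolP. Qed.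

Section Sum.
Variables (V : lmodType R) (h : I -> {linear U -> V}).

Definition dsum_sum_fun x : V := \sum_(i \in supp x) h i (x i).

Lemma dsum_sum_widen x (A : set {classic I}) : finite_set A ->
  (supp x `<=` A)%classic -> dsum_sum_fun x = \sum_(i \in A) h i (x i).
Proof.
move=> finA sA; apply: fsbig_widen => // i [_ /= ni].
by rewrite (_ : x i = 0) ?raddf0 //; apply: contra_notP ni.
Qed.

Lemma dsum_sum_linear : linear dsum_sum_fun.
Proof.
move=> r x y; pose A := (supp x `|` supp y)%classic.
have finA : finite_set A by rewrite finite_setU; split; exact: supp_finite.
rewrite (@dsum_sum_widen x A) //; last by move=> i; left.
rewrite (@dsum_sum_widen y A) //; last by move=> i; right.
rewrite (@dsum_sum_widen _ A) // => [|i /=].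
  rewrite !fsbig_finite // scaler_sumr -big_split /=.
  by apply: eq_bigr => i _; rewrite -linearP.
move=> n0; have [x0|] := pselect (x i = 0); last by left.
by right=> /= y0; apply: n0; rewrite -[LHS]/(r *: x i + y i) x0 y0 scaler0 addr0.
Qed.

Definition dsum_sum : {linear dsum I U -> V} := mklin dsum_sum_linear.

Lemma dsum_sum_inj i u : dsum_sum (dsum_inj i u) = h i u.
Proof.
rewrite mklinE (@dsum_sum_widen _ [set i]%classic).
- by rewrite fsbig_set1 dsum_inj_same.
- exact: finite_set1.
by move=> j; rewrite /supp mklinE /= /inj_fun; case: asboolP.
Qed.
End Sum.

Lemma dsum_sum_id x : dsum_sum dsum_inj x = x.
Proof.
have ev_lin j : linear (fun x : dsum I U => x j) by [].
apply: dsumP => j; rewrite mklinE /dsum_sum_fun fsbig_finite; last first.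
  exact: supp_finite.
rewrite -(mklinE (ev_lin j)) raddf_sum -fsbig_finite; last exact: supp_finite.
have [xj|xj] := pselect (x j = 0).
  rewrite xj fsbig1 // => i _; rewrite /= (mklinE (ev_lin j)).
  have [->|] := pselect (i = j).
    by rewrite dsum_inj_same.
  exact: dsum_inj_diff.
rewrite (fsbigE [:: j : {classic I}]) //.
- rewrite big_cons big_nil ifT /= ?addr0; last exact/mem_set.
  by rewrite /= (mklinE (ev_lin j)) dsum_inj_same.
- by move=> i /=; rewrite inE => /eqP ->.
by move=> i _; rewrite inE /= (mklinE (ev_lin j)) => /eqP ij; rewrite dsum_inj_diff.
Qed.

Lemma dsum_ind (X : dsum I U -> Prop) :
  X 0 -> (forall x y, X x -> X y -> X (x + y)) ->
  (forall i u, X (dsum_inj i u)) -> forall x, X x.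
Proof.
move=> X0 XD Xi x; rewrite -[x]dsum_sum_id mklinE /dsum_sum_fun.
rewrite fsbig_finite; last exact: supp_finite.
by apply: big_ind => // i _; exact: Xi.
Qed.
End DsumTheory.
Arguments dsum_inj {R I U} i.

(** * Bijective linear maps and functoriality of P ⊗ - *)

Lemma inj_surj_bij (A B : Type) (f : A -> B) :
  injective f -> surjective f -> bijective f.
Proof. by move=> injf /choice[g fg]; exists g => // x; exact/injf/fg. Qed.

Lemma bij_surj (A B : Type) (f : A -> B) : bijective f -> surjective f.
Proof. by case=> g _ gK y; exists (g y). Qed.

Section LinearBijection.
Variables (R : pzRingType) (U V : lmodType R) (f : {linear U -> V}).

Lemma linear_inj : (forall x, f x = 0 -> x = 0) -> injective f.
Proof.
move=> f0 x y fxy; apply/eqP; rewrite -subr_eq0; apply/eqP/f0.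
by rewrite raddfB /= fxy subrr.
Qed.

Lemma linear_bij_inv : bijective f ->
  exists g : {linear V -> U}, cancel f g /\ cancel g f.
Proof.
case=> g fK gK.
have lin_g : linear g by move=> r x y; apply: (can_inj fK); rewrite linearP !gK.
by exists (mklin lin_g); split=> x; rewrite mklinE.
Qed.
End LinearBijection.

Section TensorMap.
Variables (R S : pzRingType) (P : bimodType R S).

Section Map.
Variables (L N : lmodType S) (f : {linear L -> N}).

Definition tens_map_fun : tens P L -> tens P N := tens_lift (fun p l => p ⊗ f l).

Lemma tens_map_balanced : balanced (fun (p : P) l => p ⊗ f l).
Proof.
split=> [p p' u|p u u'|p s u]; first exact: tens_mkDl.
  by rewrite raddfD tens_mkDr.
by rewrite linearZ tens_mk_bal.
Qed.

Lemma tens_map_linear : linear tens_map_fun.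
Proof.
by apply: (tens_lift_linear tens_map_balanced) => r p u; rewrite tens_mkZ.
Qed.

Definition tens_map : {linear tens P L -> tens P N} := mklin tens_map_linear.

Lemma tens_map_mk p l : tens_map (p ⊗ l) = p ⊗ f l.
Proof. by rewrite mklinE; exact: (tens_lift_mk tens_map_balanced). Qed.
End Map.

Lemma tens_linear_ext (L : lmodType S) (A : zmodType) (f g : {additive tens P L -> A}) :
  (forall p l, f (p ⊗ l) = g (p ⊗ l)) -> f =1 g.
Proof.
by move=> fg; elim/tens_ind => [|z w hz hw|//]; rewrite ?raddf0 // !raddfD hz hw.
Qed.

Lemma tens_evalE (K : lmodType R) p (f : HomM P K) : tens_eval (p ⊗ f) = f p.
Proof. exact: (tens_lift_mk (@eval_balanced _ _ P K)). Qed.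

Lemma hom_ext (K : lmodType R) (f g : HomM P K) : (forall p, f p = g p) -> f = g.
Proof. exact: linear_ext. Qed.

Lemma hom_scaleE (K : lmodType R) s (f : HomM P K) p : (s *: f : HomM P K) p = f (p *r s).
Proof. by []. Qed.

Lemma hom_addE (K : lmodType R) (f g : HomM P K) p : (f + g : HomM P K) p = f p + g p.
Proof. by []. Qed.

Lemma hom_postE (K K' : lmodType R) (g : {linear K -> K'}) (f : HomM P K) p :
  hom_post g f p = g (f p).
Proof. by []. Qed.

Lemma tens_coevalE (L : lmodType S) (l : L) p : tens_coeval P l p = p ⊗ l.
Proof. by []. Qed.

Lemma hom_0E (K : lmodType R) (p : P) : (0 : HomM P K) p = 0.
Proof. by []. Qed.

Lemma tens_mk0 (L : lmodType S) (p : P) : p ⊗ (0 : L) = 0.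
Proof. by rewrite -tens_coevalE raddf0. Qed.

Lemma tens_coeval_map (L N : lmodType S) (f : {linear L -> N}) l :
  tens_coeval P (f l) = hom_post (tens_map f) (tens_coeval P l).
Proof. by apply: hom_ext => p; rewrite hom_postE !tens_coevalE tens_map_mk. Qed.

Lemma tens_coeval_inj (L : lmodType S) :
  (forall l : L, (forall p : P, p ⊗ l = 0) -> l = 0) ->
  injective (@tens_coeval R S P L).
Proof.
by move=> h; apply: linear_inj => l l0; apply: h => p; rewrite -tens_coevalE l0.
Qed.
End TensorMap.

(** * Generated and presented modules *)

Section Generators.
Variables (R S : pzRingType) (P : bimodType R S).

(** [P ⊗ L] is a quotient of P^(L): the copy of P at index [l] is mapped by p to p ⊗ l. *)
Lemma Gen_surj_tens (K : lmodType R) (L : lmodType S) (e : {linear tens P L -> K}) :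
  surjective e -> Gen P K.
Proof.
move=> se; pose h (l : L) : {linear P -> K} := e \o (tens_coeval P l : {linear _ -> _}).
exists L, (dsum_sum h) => k; have [z <-] := se k.
elim/tens_ind: z => [|z w [x xz] [y yw]|p l].
- by exists 0; rewrite !raddf0.
- by exists (x + y); rewrite !raddfD /= xz yw.
by exists (dsum_inj l p); rewrite dsum_sum_inj.
Qed.

Lemma Gen_tens (L : lmodType S) : Gen P (tens P L).
Proof. by apply: (@Gen_surj_tens _ _ idfun) => z; exists z. Qed.

(** The image of evaluation is the trace of P in K, the sum of the images of all maps P -> K; maps
    out of direct sums of P take values in it. *)
Lemma Gen_eval (K : lmodType R) : Gen P K <-> surjective (@tens_eval _ _ P K).
Proof.
split; last exact: Gen_surj_tens.
move=> [I [g sg]] k; have [x <-] := sg k.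
elim/dsum_ind: x => [|x y [z zx] [w wy]|i p].
- by exists 0; rewrite !raddf0.
- by exists (z + w); rewrite !raddfD /= zx wy.
pose f : HomM P K := (g \o dsum_inj i : {linear P -> K}).
by exists (p ⊗ f); rewrite tens_evalE.
Qed.

Lemma Gen_factor (K V : lmodType R) (g : {linear K -> V}) :
  surjective g -> Gen P K -> Gen P V.
Proof.
move=> sg [I [h sh]]; exists I, (g \o h) => v.
by have [k <-] := sg v; have [x <-] := sh k; exists x.
Qed.

Lemma Gen_dsum I : Gen P (dsum I P).
Proof. by exists I, idfun => x; exists x. Qed.

Lemma Pres_Gen V : Pres P V -> Gen P V.
Proof. by move=> [I [J [f [g [_ sg]]]]]; exists I, g. Qed.

Section Presentation.
Variable V : lmodType R.

Definition hom_cover : {linear dsum (HomM P V) P -> V} := dsum_sum (@hom_fun _ _ P V).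

(** Indexing by all maps from P into the kernel of the cover makes the image of [hom_cover_syz] the
    trace of P in that kernel. *)
Definition hom_cover_rel := {h : {linear P -> dsum (HomM P V) P} |
  forall p, hom_cover (h p) = 0}.

Definition hom_cover_syz : {linear dsum hom_cover_rel P -> dsum (HomM P V) P} :=
  dsum_sum (fun h => sval h).

(** Reads a formal sum of pairs (p, f) in the direct sum, placing p at index f. *)
Let sigma (s : seq (P * HomM P V)) : dsum (HomM P V) P :=
  \sum_(x <- s) dsum_inj x.2 x.1.

Let syz_rel (h : {linear P -> dsum (HomM P V) P}) p :
  (forall p, hom_cover (h p) = 0) -> exists y, hom_cover_syz y = h p.
Proof.
move=> h0; exists (dsum_inj (exist _ h h0 : hom_cover_rel) p).
by rewrite dsum_sum_inj.
Qed.

(* Each defining relation of the tensor product is the value at some p of a map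
   from P into the kernel of the cover. *)
Lemma tens_rel_syz s t : tens_rel s t -> exists y, hom_cover_syz y = sigma s - sigma t.
Proof.
elim=> {s t} [s|s t _ [y yst]|s t r _ [y yst] _ [z ztr]|s t s' t' _ [y yst] _ [z zst]
  |s t|u|p p' u|p u u'|p s u]; rewrite /sigma ?big_cat ?big_cons ?big_nil /= ?addr0.
- by exists 0; rewrite raddf0 subrr.
- by exists (- y); rewrite raddfN /= yst opprB.
- by exists (y + z); rewrite raddfD /= yst ztr addrA subrK.
- by exists (y + z); rewrite raddfD /= yst zst opprD addrACA.
- by exists 0; rewrite raddf0 [in X in _ - X]addrC subrr.
- by exists 0; rewrite subr0 !raddf0.
- by exists 0; rewrite raddf0 raddfD subrr.
(* Additivity in [u] and balance are the only defining relations that do not already hold in the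
   direct sum, where [dsum_inj] is additive in [p]. *)
- pose h := dsum_inj (u + u') \-
    (dsum_inj u \+ dsum_inj u' : {linear P -> dsum (HomM P V) P}).
  apply: (@syz_rel h) => q; rewrite /h /= raddfB raddfD /= !dsum_sum_inj.
  by rewrite hom_addE subrr.
pose h0 q : dsum (HomM P V) P := dsum_inj u (q *r s) - dsum_inj (s *: u) q.
have lin_h : linear h0.
  move=> r x y; rewrite /h0 ractDl ractZ !linearP /=.
  by rewrite scalerBr addrACA scalerN.
have [q|y yh] := @syz_rel (mklin lin_h) p; last by exists y; rewrite yh (mklinE lin_h).
by rewrite (mklinE lin_h) /h0 raddfB /= !dsum_sum_inj hom_scaleE subrr.
Qed.

(** A kernel element of the cover is [sigma s] for a list [s] whose tensor evaluates to 0.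
    Injectivity makes [s] equivalent to the empty list, and [tens_rel_syz] then puts [sigma s] in
    the image of [hom_cover_syz]. *)
Lemma Gen_Pres : injective (@tens_eval _ _ P V) -> Gen P V -> Pres P V.
Proof.
move=> injev /Gen_eval sev.
have sig x : exists s, x = sigma s.
  elim/dsum_ind: x => [|x y [s ->] [t ->]|f p].
  - by exists [::]; rewrite /sigma big_nil.
  - by exists (s ++ t); rewrite /sigma big_cat.
  by exists [:: (p, f)]; rewrite /sigma big_seq1.
have coverE s : hom_cover (sigma s) = tens_eval (\pi_(tens P (HomM P V)) s)%qT.
  rewrite tens_piE /sigma !raddf_sum; apply: eq_bigr => x _.
  by rewrite /= tens_evalE dsum_sum_inj.
exists (HomM P V), hom_cover_rel, hom_cover_syz, hom_cover; split=> [x|v].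
  split=> [x0|[y <-]].
    have [s xs] := sig x; rewrite xs coverE in x0.
    have : (\pi_(tens P (HomM P V)) s = \pi_(tens P (HomM P V)) [::])%qT.
      by apply: injev; rewrite x0 tens_piE big_nil raddf0.
    move/tensP => /tens_rel_syz[y ys]; exists y.
    by rewrite ys xs /sigma big_nil subr0.
  elim/dsum_ind: y => [|y z /= hy hz|h p]; first by rewrite !raddf0.
    by rewrite !raddfD /= hy hz addr0.
  by rewrite dsum_sum_inj; case: h.
have [z <-] := sev v; rewrite -[z]tens_repr.
by exists (sigma (repr z)); rewrite coverE.
Qed.
End Presentation.
End Generators.

(** * Hom into products; cogenerated and copresented modules *)

Section HomProduct.
Variables (R S : pzRingType) (P : bimodType R S) (I : Type) (E : lmodType R).

Lemma proj_linear (U : lmodType R) i : linear (fun y : I -> U => y i).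
Proof. by []. Qed.

Definition proj (U : lmodType R) i : {linear (I -> U) -> U} := mklin (@proj_linear U i).

Lemma projE (U : lmodType R) i (y : I -> U) : proj U i y = y i.
Proof. exact: mklinE. Qed.

Let tuple_fun (y : I -> HomM P E) (p : P) : I -> E := fun i => y i p.

Let tuple_linear y : linear (tuple_fun y).
Proof. by move=> r p q; apply/funext => i; rewrite /tuple_fun linearP. Qed.

Let tuple (y : I -> HomM P E) : HomM P (I -> E) := mklin (tuple_linear y).

Let tupleE y p i : tuple y p i = y i p.
Proof. by rewrite /tuple /hom_fun mklinE. Qed.

Lemma hom_tuple_linear : linear tuple.
Proof.
move=> s x y; apply: hom_ext => p; apply/funext => i.
rewrite hom_addE hom_scaleE -[RHS]/(_ i + _ i) !tupleE.
by rewrite -[LHS]/((s *: x i + y i : HomM P E) p) hom_addE hom_scaleE.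
Qed.

Definition hom_tuple : {linear (I -> HomM P E) -> HomM P (I -> E)} :=
  mklin hom_tuple_linear.

Lemma hom_tupleE y p i : hom_tuple y p i = y i p.
Proof. by rewrite /hom_tuple mklinE tupleE. Qed.

Lemma hom_tuple_inj : injective hom_tuple.
Proof.
move=> x y xy; apply/funext => i; apply: hom_ext => p.
by rewrite -!hom_tupleE xy.
Qed.

Lemma hom_tuple_surj : surjective hom_tuple.
Proof.
move=> f; exists (fun i => hom_post (proj E i) f); apply: hom_ext => p.
by apply/funext => i; rewrite hom_tupleE hom_postE projE.
Qed.
End HomProduct.

Section Cogenerated.
Variables (R S : pzRingType) (P : bimodType R S) (E : lmodType R).

Lemma Cogen_sub (U L N : lmodType S) (f : {linear L -> N}) :
  injective f -> Cogen U N -> Cogen U L.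
Proof. by move=> injf [I [g injg]]; exists I, (g \o f); apply: inj_comp. Qed.

Lemma Cogen_prod (U : lmodType S) I : Cogen U (I -> U).
Proof. by exists I, idfun. Qed.

Lemma hom_post_inj (K N : lmodType R) (i : {linear K -> N}) :
  injective i -> injective (@hom_post _ _ P _ _ i).
Proof.
move=> inji f g fg; apply: hom_ext => p; apply: inji.
by rewrite -!hom_postE fg.
Qed.

Lemma hom_post_exact (K N V : lmodType R) (i : {linear K -> N}) (g : {linear N -> V}) :
  injective i -> exact_at i g ->
  exact_at (@hom_post _ _ P _ _ i) (@hom_post _ _ P _ _ g).
Proof.
move=> inji exg y; split=> [y0|[f <-]]; last first.
  by apply: hom_ext => p; rewrite !hom_postE; apply/exg; exists (f p).
have /choice[f fy] p : exists k, i k = y p.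
  by apply/exg; rewrite -hom_postE y0.
have lin_f : linear f by move=> r p q; apply: inji; rewrite linearP !fy linearP.
exists (mklin lin_f); apply: hom_ext => p.
by rewrite hom_postE {1}/hom_fun mklinE fy.
Qed.

Lemma Cogen_hom (K : lmodType R) : Cogen E K -> Cogen (HomM P E) (HomM P K).
Proof.
move=> [A [i inji]].
have [h [hK Kh]] := linear_bij_inv
  (inj_surj_bij (@hom_tuple_inj _ _ P A E) (@hom_tuple_surj _ _ P A E)).
exists A, (h \o @hom_post _ _ P _ _ i).
exact: inj_comp (can_inj Kh) (hom_post_inj inji).
Qed.

(** Embed K in a power of E and the cokernel in another; Hom(P,-) keeps the sequence exact and turns
    powers of E into powers of Hom(P,E). *)
Lemma Copres_hom (K : lmodType R) : cogenerator E -> Copres (HomM P E) (HomM P K).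
Proof.
move=> cogE; have [A [i inji]] := cogE K.
have [C [g exg]] := coker_exists i; have [B [j injj]] := cogE C.
have [hA [hAK KhA]] := linear_bij_inv
  (inj_surj_bij (@hom_tuple_inj _ _ P A E) (@hom_tuple_surj _ _ P A E)).
have [hB [hBK KhB]] := linear_bij_inv
  (inj_surj_bij (@hom_tuple_inj _ _ P B E) (@hom_tuple_surj _ _ P B E)).
exists A, B, (hA \o @hom_post _ _ P _ _ i),
  (hB \o (@hom_post _ _ P _ _ (j \o g) \o hom_tuple P A E)).
have exjg : exact_at i (j \o g).
  move=> y; rewrite -exg /=; split=> [|->]; last by rewrite raddf0.
  by rewrite -(raddf0 j) => /injj.
split; first exact: inj_comp (can_inj KhA) (hom_post_inj inji).
move=> y; split=> [/= y0|[f <-]]; last first.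
  by rewrite /= KhA (proj2 (hom_post_exact inji exjg _)) ?raddf0 //; exists f.
have /(hom_post_exact inji exjg)[f fy] : hom_post (j \o g) (hom_tuple P A E y) = 0.
  by apply: (can_inj KhB); rewrite y0 raddf0.
by exists f; rewrite /= fy hAK.
Qed.

(** For linear f : L -> Hom(P,E), evaluating (P ⊗ f)(p ⊗ l) gives f(l)(p). If all p ⊗ l vanish, so
    does every f(l), and such maps f separate the elements of L. *)
Lemma coeval_Cogen_inj (L : lmodType S) :
  Cogen (HomM P E) L -> injective (@tens_coeval _ _ P L).
Proof.
move=> [A [f injf]]; apply: tens_coeval_inj => l l0; apply: injf.
rewrite raddf0; apply/funext => a; apply: hom_ext => p.
have := congr1 (fun z => tens_eval (tens_map P (proj _ a \o f) z)) (l0 p).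
by rewrite /= tens_map_mk tens_evalE /= projE !raddf0 => ->.
Qed.

Lemma Adstat_Cogen (L : lmodType S) : cogenerator E -> Adstat P L -> Cogen (HomM P E) L.
Proof.
move=> cogE adL; apply: (@Cogen_sub _ _ _ (@tens_coeval _ _ P L)).
  exact: bij_inj.
exact/Cogen_hom/cogE.
Qed.
End Cogenerated.

(** * Equivalences of categories from Hom and tensor *)

Lemma nat_iso_sym (A B : category) (F G : cfunctor A B) : nat_iso F G -> nat_iso G F.
Proof.
move=> [eta [iso nat]].
have inv X : {h : mor (G X) (F X) | compm h (eta X) = idm _ /\ compm (eta X) h = idm _}.
  exact/cid/iso.
exists (fun X => sval (inv X)); split=> [X|X Y f].
  by exists (eta X); case: (inv X) => h [].
case: (inv X) (inv Y) => [hX [h1 h2]] [hY [h3 h4]] /=.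
by rewrite -[LHS]compm1 -h2 compmA -(compmA _ _ (eta X)) -nat compmA h3 comp1m.
Qed.

Lemma equivalent_sym (A B : category) : equivalent A B -> equivalent B A.
Proof. by move=> [F' [G' [h1 h2]]]; exists G', F'. Qed.
Section Equivalence.
Variables (R S : pzRingType) (P : bimodType R S) (C : modclass R) (D : modclass S).

Hypothesis homC : forall K, C K -> D (HomM P K).
Hypothesis tensD : forall L, D L -> C (tens P L).
Hypothesis statC : forall K, C K -> Stat P K.
Hypothesis adstatD : forall L, D L -> Adstat P L.

Let F : cfunctor (full_subcat C) (full_subcat D).
Proof.
apply: (@CFunctor (full_subcat C) (full_subcat D)
  (fun X => exist D (HomM P (sval X)) (homC (svalP X)))
  (fun X Y (f : {linear sval X -> sval Y}) => @hom_post _ _ P _ _ f : {linear _ -> _})).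
- by move=> X; apply: linear_ext => f; apply: hom_ext.
by move=> X Y Z g f; apply: linear_ext => h; apply: hom_ext.
Defined.

Let G : cfunctor (full_subcat D) (full_subcat C).
Proof.
apply: (@CFunctor (full_subcat D) (full_subcat C)
  (fun X => exist C (tens P (sval X)) (tensD (svalP X)))
  (fun X Y (f : {linear sval X -> sval Y}) => tens_map P f)).
- by move=> X; apply: linear_ext; apply: tens_linear_ext => p l; rewrite /= tens_map_mk.
move=> X Y Z g f; apply: linear_ext; apply: tens_linear_ext => p l.
by rewrite /= !tens_map_mk.
Defined.

(** Evaluation and coevaluation are the counit and unit of the Hom-tensor adjunction; [statC] and
    [adstatD] make them invertible. *)
Lemma hom_tens_equivalence : equivalent (full_subcat C) (full_subcat D).
Proof.
exists F, G; split.
  exists (fun X => @tens_eval _ _ P (sval X) : {linear _ -> _}); split=> [X|X Y f].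
    have [g [gK Kg]] := linear_bij_inv (statC (svalP X)).
    by exists g; split; apply: linear_ext.
  apply: linear_ext; apply: tens_linear_ext => p h.
  by rewrite /= tens_map_mk !tens_evalE.
(* Coevaluation starts at the identity functor, opposite to the direction required. *)
apply: nat_iso_sym.
exists (fun X => @tens_coeval _ _ P (sval X) : {linear _ -> _}); split=> [X|X Y f].
  have [g [gK Kg]] := linear_bij_inv (adstatD (svalP X)).
  by exists g; split; apply: linear_ext.
by apply: linear_ext => l; exact: tens_coeval_map.
Qed.

End Equivalence.

(** * Consequences of the alpha-condition over S *)

Lemma ract0 (R S : pzRingType) (P : bimodType R S) (p : P) : p *r (0 : S) = 0.
Proof. by apply: (addrI (p *r 0)); rewrite -ractDr !addr0. Qed.

Section AlphaCondition.
Variables (T S : pzRingType) (P : bimodType T S) (Q : bimodType S T).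
Variables (M : morita_context P Q) (alM : alphaP M).

Lemma alpha_mapE (U : lmodType S) p (u : U) q :
  alpha_map (mc_S M) (p ⊗ u) q = (mc_S M (q ⊗ p) : S) *: u.
Proof. by rewrite /alpha_map (tens_lift_mk (@alpha_balanced _ _ _ _ _ U)). Qed.

(** For z = p' ⊗ u, moving <q,p'>_S across the tensor sign turns p<q,p'>_S into <p,q>_T p'. *)
Lemma tens_alpha (U : lmodType S) (z : tens P U) p q :
  p ⊗ alpha_map (mc_S M) z q = (mc_T M (p ⊗ q) : T) *: z.
Proof.
elim/tens_ind: z => [|z w hz hw|p' u].
- by rewrite raddf0 hom_0E tens_mk0 scaler0.
- rewrite raddfD -[X in p ⊗ X]/(alpha_map _ z q + alpha_map _ w q) tens_mkDr.
  by rewrite hz hw scalerDr.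
by rewrite alpha_mapE -tens_mk_bal mc_assocP tens_mkZ.
Qed.

(** If z evaluates to 0, evaluating p ⊗ alpha(z)(q) = <p,q>_T z gives alpha(z)(q)(p) = 0 for all p
    and q, so alpha(z) = 0. *)
Lemma tens_eval_inj (K : lmodType T) : injective (@tens_eval _ _ P K).
Proof.
apply: linear_inj => z z0; apply: alM; rewrite raddf0; apply: hom_ext => q.
apply: hom_ext => p; have /= := congr1 (@tens_eval _ _ P K) (tens_alpha z p q).
by rewrite tens_evalE linearZ /= z0 scaler0.
Qed.

(** Flatness of P comes from naturality of alpha: f(alpha(z)(q)) = alpha((P ⊗ f) z)(q), and f is
    injective. *)
Lemma tens_map_inj (L N : lmodType S) (f : {linear L -> N}) :
  injective f -> injective (tens_map P f).
Proof.
move=> injf; apply: linear_inj => z z0; apply: alM; rewrite raddf0.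
apply: hom_ext => q; apply: injf.
have -> : f (alpha_map (mc_S M) z q) = alpha_map (mc_S M) (tens_map P f z) q.
  elim/tens_ind: z {z0} => [|z w hz hw|p u]; first by rewrite !raddf0.
    by rewrite !raddfD /= hz hw.
  by rewrite tens_map_mk !alpha_mapE linearZ.
by rewrite z0 !raddf0.
Qed.

Lemma Gen_Stat : same_class (Gen P) (Stat P).
Proof.
move=> K; split=> [/Gen_eval sK|bK]; first exact: inj_surj_bij (@tens_eval_inj K) sK.
exact/Gen_eval/bij_surj.
Qed.

Lemma Gen_eq_Pres : same_class (Gen P) (Pres P).
Proof.
move=> V; split; last exact: Pres_Gen.
exact/Gen_Pres/tens_eval_inj.
Qed.

Lemma Adstat_hom (K : lmodType T) : Adstat P (HomM P K).
Proof.
apply: inj_surj_bij.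
  apply: (@coeval_Cogen_inj _ _ _ K); apply: Cogen_hom; exists unit.
  exists (@mklin _ K (unit -> K) (fun k _ => k) (fun r x y => erefl)) => x y.
  by rewrite !mklinE => /(congr1 (fun f => f tt)).
(* The two maps are compared after evaluation, which is injective. *)
move=> f; exists (hom_post (@tens_eval _ _ P K) f); apply: hom_ext => p.
by apply: tens_eval_inj; rewrite tens_coevalE tens_evalE.
Qed.

(** Coevaluation in N yields x with image (P ⊗ i) f, injectivity at N' forces g x = 0, and the
    preimage of x in L maps to f because P ⊗ i is injective. *)
Lemma Adstat_kernel (L N N' : lmodType S) (i : {linear L -> N}) (g : {linear N -> N'}) :
  injective i -> exact_at i g -> Adstat P N -> injective (@tens_coeval _ _ P N') ->
  Adstat P L.
Proof.
move=> inji exg adN injN'; apply: inj_surj_bij => [l m lm|f].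
  apply/inji/(bij_inj adN).
  by rewrite !tens_coeval_map lm.
have [x xf] := bij_surj adN (hom_post (tens_map P i) f).
have /exg[l lx] : g x = 0.
  apply: injN'; rewrite tens_coeval_map xf raddf0; apply: hom_ext => p.
  rewrite !hom_postE; elim/tens_ind: (f p) => [|z w hz hw|q l].
  - by rewrite !raddf0.
  - by rewrite !raddfD /= hz hw addr0.
  rewrite !tens_map_mk (_ : g (i l) = 0); last by apply/exg; exists l.
  exact: tens_mk0.
exists l; apply: (hom_post_inj (tens_map_inj inji)).
by rewrite -tens_coeval_map lx.
Qed.

Lemma Adstat_prod (E : lmodType T) I : Adstat P (I -> HomM P E).
Proof.
have adH := Adstat_hom (I -> E).
(* The isomorphism of the product with Hom(P,E^I) is presented as the kernel of a zero map, so that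
   [Adstat_kernel] transports adstaticity. *)
apply: (@Adstat_kernel _ _ _ (hom_tuple P I E) (\0 : {linear _ -> HomM P (I -> E)})).
- exact: hom_tuple_inj.
- by move=> y; split=> // _; exact: hom_tuple_surj.
- exact: adH.
exact: bij_inj adH.
Qed.

Lemma Copres_Adstat (E : lmodType T) (L : lmodType S) :
  Copres (HomM P E) L -> Adstat P L.
Proof.
move=> [I [J [f [g [injf exg]]]]]; apply: (Adstat_kernel injf exg (Adstat_prod _ _)).
exact/coeval_Cogen_inj/Cogen_prod.
Qed.

Lemma Gen_Copres_equivalence (E : lmodType T) : cogenerator E ->
  equivalent (full_subcat (Gen P)) (full_subcat (Copres (HomM P E))).
Proof.
move=> cogE; apply: (@hom_tens_equivalence _ _ P) => [K _|L _|K /Gen_Stat //|L].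
- exact: Copres_hom.
- exact: Gen_tens.
exact: Copres_Adstat.
Qed.

Lemma ideal_class_Adstat (L : lmodType S) :
  injective (@tens_coeval _ _ P L) -> ideal_class (mc_S M) L -> Adstat P L.
Proof.
move=> injL idL; apply: inj_surj_bij => // f.
(* For j = <q,p'>_S the witness is alpha(f p')(q), since p ⊗ alpha(f p')(q) = <p,q>_T f(p') = f(p
   j). Witnesses are unique by [injL], so psi is linear. *)
have /choice[psi psiE] (j : bimod_img (mc_S M)) :
    exists l, forall p, p ⊗ l = f (p *r (img_val j : S)).
  have /img_predP[w <-] := valP j.
  elim/tens_ind: w => [|w w' [l hl] [l' hl']|q p'].
  - by exists 0 => p; rewrite tens_mk0 raddf0 ract0 raddf0.
  - by exists (l + l') => p; rewrite tens_mkDr hl hl' raddfD /= ractDr raddfD.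
  exists (alpha_map (mc_S M) (f p') q) => p.
  by rewrite tens_alpha mc_assocP linearZ.
have lin_psi : linear psi.
  move=> s x y; apply: injL; apply: hom_ext => p.
  rewrite !tens_coevalE psiE tens_mkDr -tens_mk_bal !psiE.
  by rewrite -raddfD ractA -ractDr.
have [l lpsi] := bij_surj idL (mklin lin_psi).
(* To compare p' ⊗ l with f(p'), apply alpha, evaluate at q and tensor with p: for j = <q,p'>_S this
   leaves p ⊗ j l and f(p j) = p ⊗ psi(j), and psi(j) = j l. *)
exists l; apply: hom_ext => p'; apply/eqP; rewrite -subr_eq0; apply/eqP.
rewrite tens_coevalE; apply: alM; rewrite raddf0; apply: hom_ext => q.
apply: injL; apply: hom_ext => p; rewrite raddf0 tens_coevalE tens_alpha.
rewrite scalerBr -linearZ -mc_assocP tens_mkZ -mc_assocP tens_mk_bal.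
pose j : bimod_img (mc_S M) :=
  BimodImg (introT (img_predP _ _) (ex_intro _ (q ⊗ p') erefl)).
rewrite -[mc_S M (q ⊗ p')]/(img_val j) -psiE.
have := congr1 (fun h : HomM (bimod_img (mc_S M)) L => h j) lpsi.
by rewrite {2}/hom_fun mklinE => <-; rewrite subrr.
Qed.

(** Flatness and injective evaluation make P ⊗ C -> V an isomorphism; along it f becomes a map P ->
    P ⊗ C, which is the coevaluation of some c, and j(c) = f. *)
Lemma span_surj (C : lmodType S) (V : lmodType T) (j : {linear C -> HomM P V}) :
  Adstat P C -> injective j ->
  surjective (fun z => tens_eval (tens_map P j z)) -> surjective j.
Proof.
move=> adC injj sur f; pose e := @tens_eval _ _ P V \o tens_map P j.
have inje : injective e by apply: inj_comp (@tens_eval_inj V) (tens_map_inj injj).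
have [g [eK gK]] := linear_bij_inv (inj_surj_bij inje sur).
have [c cf] := bij_surj adC (hom_post g f); exists c; apply: hom_ext => p.
have gfp : p ⊗ c = g (f p) by rewrite -hom_postE -cf.
by have := gK (f p); rewrite -gfp /= tens_map_mk tens_evalE.
Qed.
End AlphaCondition.

(** * Cogenerated modules in the ideal class: equivalence and quasi-projectivity *)

Section QuasiProjective.
Variables (T S : pzRingType) (P : bimodType T S) (Q : bimodType S T).
Variables (M : morita_context P Q) (alM : alphaP M).
Variables (E : lmodType T) (cogE : cogenerator E).
Hypothesis idealE : forall L : lmodType S,
  Cogen (HomM P E) L -> ideal_class (mc_S M) L.

Lemma Cogen_Adstat : same_class (Cogen (HomM P E)) (Adstat P).
Proof.
move=> L; split=> [cL|]; last exact: Adstat_Cogen.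
apply: (ideal_class_Adstat alM); last exact: idealE.
exact: coeval_Cogen_inj cL.
Qed.

Lemma Cogen_Gen_equivalence :
  equivalent (full_subcat (Gen P)) (full_subcat (Cogen (HomM P E))).
Proof.
apply: (@hom_tens_equivalence _ _ P) => [K _|L _|K /(Gen_Stat alM) //|L /Cogen_Adstat //].
- exact/Cogen_hom/cogE.
exact: Gen_tens.
Qed.

Lemma hom_post_dsum_surj I (V : lmodType T) (g : {linear dsum I P -> V}) :
  surjective g -> surjective (@hom_post _ _ P _ _ g).
Proof.
(* C is the image of Hom(P,g) in Hom(P,V), hence cogenerated and so adstatic; it spans V because it
   contains g composed with every coordinate inclusion. *)
move=> sg; have [C [e [i [se inji ie]]]] := image_factorization (@hom_post _ _ P _ _ g).
have adC : Adstat P C.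
  by apply/Cogen_Adstat/(Cogen_sub inji)/Cogen_hom/cogE.
suff si : surjective i by move=> f; have [c <-] := si f; have [x <-] := se c; exists x.
apply: (span_surj alM adC inji) => v; have [x <-] := sg v.
elim/dsum_ind: x => [|x y [z zx] [w wy]|k p].
- by exists 0; rewrite !raddf0.
- by exists (z + w); rewrite !raddfD /= zx wy.
pose f : HomM P (dsum I P) := dsum_inj k : {linear P -> dsum I P}.
by exists (p ⊗ e f); rewrite tens_map_mk tens_evalE ie hom_postE.
Qed.

Lemma quasi_projective I (K V : lmodType T)
    (i : {linear K -> dsum I P}) (g : {linear dsum I P -> V}) :
  short_exact i g -> short_exact (@hom_post _ _ P _ _ i) (@hom_post _ _ P _ _ g).
Proof.
move=> [inji exg sg]; split; first exact: hom_post_inj.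
  exact: hom_post_exact.
exact: hom_post_dsum_surj.
Qed.
End QuasiProjective.

(** * Self-smallness *)

Section SelfSmall.
Variables (T : pzRingType) (P : lmodType T) (Q : bimodType (endop P) T).
Variables (M : morita_context (endmod P) Q) (alM : alphaP M).
Variables (E : lmodType T) (cogE : cogenerator E).
Hypothesis idealE : forall L : lmodType (endop P),
  Cogen (HomM (endmod P) E) L -> ideal_class (mc_S M) L.

Lemma sum_homE I (f : dsum I (HomM (endmod P) P)) p i : sum_hom f p i = f i p.
Proof. by []. Qed.

Lemma sum_hom_linear I : linear (@sum_hom T P I).
Proof. by move=> s f g; apply: hom_ext => p; apply: dsumP. Qed.

Lemma sum_hom_inj I : injective (@sum_hom T P I).
Proof.
move=> f g fg; apply: dsumP => i; apply: hom_ext => p.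
by rewrite -!sum_homE fg.
Qed.

Lemma self_small_alpha : self_small P.
Proof.
move=> I; have injs : injective (mklin (@sum_hom_linear I)).
  by apply: (eq_inj (@sum_hom_inj I)) => f; rewrite mklinE.
suff /(span_surj alM) ss : Adstat (endmod P) (dsum I (HomM (endmod P) P)).
  apply: inj_surj_bij; first exact: sum_hom_inj.
  have surj : surjective (mklin (@sum_hom_linear I)).
    apply: ss => // x; elim/dsum_ind: x => [|x y [z zx] [w wy]|k p].
    - by exists 0; rewrite !raddf0.
    - by exists (z + w); rewrite !raddfD /= zx wy.
    (* Under [sum_hom], the identity placed at index k becomes the k-th inclusion of P. *)
    pose u : HomM (endmod P) P := idfun : {linear P -> P}.
    exists ((p : endmod P) ⊗ dsum_inj k u); rewrite tens_map_mk tens_evalE mklinE.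
    apply: dsumP => l; rewrite sum_homE.
    have [<-|kl] := pselect (k = l); first by rewrite !dsum_inj_same.
    by rewrite !dsum_inj_diff.
  by move=> f; have [x <-] := surj f; exists x; rewrite mklinE.
(* Hom(P,P)^(I) embeds in Hom(P,P)^I = Hom(P,P^I), which is cogenerated because P^I embeds in a
   power of E. *)
apply/(Cogen_Adstat alM cogE idealE).
have val_lin : linear (@dsum_val _ I (HomM (endmod P) P)) by [].
apply: (@Cogen_sub _ _ _ _ (@hom_tuple _ _ (endmod P) I P \o mklin val_lin)).
  apply: inj_comp; first exact: hom_tuple_inj.
  by move=> x y; rewrite !mklinE => xy; apply: dsumP => i; rewrite xy.
exact/Cogen_hom/cogE.
Qed.
End SelfSmall.

Theorem proposition6p9 (T : pzRingType) (P : lmodType T)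
    (E : lmodType T) (injE : injective_module E) (cogE : cogenerator E)
    (Q : bimodType (endop P) T) (M : morita_context (endmod P) Q) :
  (alphaP M ->
    [/\ same_class (Gen P) (Stat (endmod P)),
        equivalent (full_subcat (Gen P)) (full_subcat (Copres (dualmod P E))),
        sum_self_static P /\ factor_closed (Stat (endmod P)) &
        same_class (Gen P) (Pres P)]) /\
  (right_alpha M ->
   (forall L : lmodType (endop P),
      Cogen (dualmod P E) L -> ideal_class (mc_S M) L) ->
    [/\ same_class (Gen P) (Stat (endmod P)) /\
        same_class (Cogen (dualmod P E)) (Adstat (endmod P)),
        equivalent (full_subcat (Cogen (dualmod P E))) (full_subcat (Gen P)),
        star_module P E &
        self_tilting P /\ self_small P]).
Proof.
(* Without eta for records, [endmod P] and [P] are convertible as modules only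
   once [P] is in constructor form. *)
move: Q M; case: P => P' cP; set P := GRing.Lmodule.Pack cP => Q M.
split=> [al|[al _] idealE].
  have GS : same_class (Gen P) (Stat (endmod P)) by exact: (Gen_Stat al).
  split=> //.
  - exact: (Gen_Copres_equivalence al cogE).
  (* Both claims are read in Gen(P), which contains every P^(I) and is closed under epimorphic
     images. *)
  - split=> [I|K V g sg /GS genK]; apply/GS; first exact: (@Gen_dsum _ _ (endmod P)).
    exact: (@Gen_factor _ _ (endmod P) _ _ _ sg genK).
  exact: (Gen_eq_Pres al).
have equiv := Cogen_Gen_equivalence al cogE idealE.
split.
- split; [exact: (Gen_Stat al) | exact: (Cogen_Adstat al cogE idealE)].
- exact: equivalent_sym equiv.
- exact: equiv.
split; last exact: (self_small_alpha al cogE idealE).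
split; last exact: (Gen_eq_Pres al).
by move=> I K V i g ex _; exact: (quasi_projective al cogE idealE ex).
Qed.
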